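(* Let $n$ be a positive integer satisfying $\ell(2n) = \ell(n)+1$. If $\ell(2^n-1) \leq \ell(n) + n - 1$ (that is, the Scholz conjecture holds for $n$), then $\ell(2^{2n}-1) \leq \ell(2n) + 2n - 1$ (that is, the Scholz conjecture also holds for $2n$).
   Context: An addition chain for a positive integer $n$ is a finite sequence $a_0=1, a_1, a_2, \ldots, a_r$ of positive integers with $a_r = n$ such that every element $a_k$ with $k \geq 1$ is the sum $a_i + a_j$ of two previous elements ($0 \le i, j < k$, with $i=j$ allowed). The integer $r$ is the length of the chain. For a positive integer $n$, $\ell(n)$ denotes the minimal length of all addition chains for $n$. The Scholz conjecture is said to hold for a positive integer $n$ if $\ell(2^n-1) \leq \ell(n) + n - 1$. *)

(* Defs.v *)
From mathcomp Require Import all_boot.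
From mathcomp Require Import boolp.

Set Implicit Arguments.
Unset Strict Implicit.
Unset Printing Implicit Defensive.

(* The sequence a = [:: a_0; ...; a_r] has r.+1 entries, so r is its length as
   a chain.  It is not required to be increasing. *)
Definition addition_chain (n r : nat) (a : seq nat) : Prop :=
  [/\ size a = r.+1,
      all (fun x => 0 < x) a,
      nth 0 a 0 = 1,
      nth 0 a r = n
    & forall k, 0 < k <= r ->
        exists i j, [/\ i < k, j < k & nth 0 a k = nth 0 a i + nth 0 a j]].

Definition has_chain_of_length (n r : nat) : Prop :=
  exists a : seq nat, addition_chain n r a.

Lemma has_chain_iota (n : nat) : 0 < n -> has_chain_of_length n n.-1.
Proof.
case: n => // n _; exists (iota 1 n.+1); split; rewrite ?size_iota //.
- by apply/allP => x; rewrite mem_iota => /andP[].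
- by rewrite nth_iota.
- move=> [|k] // /andP[_ le_kn]; exists k, 0; split=> //.
  by rewrite !nth_iota ?(ltnW (leq_ltn_trans le_kn _)) //= ?addn1 ?add1n.
Qed.

(* The premise 0 < n only serves to make the function total: ell 0 = 0 is a
   dummy value. *)
Lemma ell_subproof (n : nat) :
  exists r, `[< 0 < n -> has_chain_of_length n r >].
Proof. by exists n.-1; apply/asboolP; apply: has_chain_iota. Qed.

Definition ell (n : nat) : nat := ex_minn (ell_subproof n).

Lemma ellP (n : nat) : 0 < n ->
  has_chain_of_length n (ell n) /\
  (forall r, has_chain_of_length n r -> ell n <= r).
Proof.
move=> n_gt0; rewrite /ell; case: ex_minnP => m /asboolP m_chain m_min.
by split=> [|r r_chain]; [apply: m_chain | apply/m_min/asboolP].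
Qed.

(* Main.v *)
Require Import Defs.
From mathcomp Require Import all_boot.
From mathcomp Require Import zify.

(** Put m = 2^n - 1.  Then 2^(2n) - 1 = 2^n m + m, so a chain for m extends to
    one for 2^(2n) - 1 by n doublings followed by one addition of m.  These
    n + 1 extra steps are exactly what the bound for 2n allows. *)

Lemma addition_chain_last (n r : nat) (a : seq nat) :
  addition_chain n r a -> n \in a.
Proof. by case=> sz_a _ _ <- _; rewrite mem_nth ?sz_a. Qed.

(** Chains need not be increasing, so the new sum is never compared with [n]; only the condition at
    the new last index has to be supplied. *)
Lemma addition_chain_rcons (n r : nat) (a : seq nat) (x y : nat) :
  addition_chain n r a -> x \in a -> y \in a ->
  addition_chain (x + y) r.+1 (rcons a (x + y)).
Proof.
move=> [sz_a a_gt0 a0 ar a_step] xa ya; split.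
- by rewrite size_rcons sz_a.
- by rewrite all_rcons a_gt0 addn_gt0 (allP a_gt0 _ xa).
- by rewrite nth_rcons sz_a.
- by rewrite nth_rcons sz_a ltnn eqxx.
move=> k /andP[k_gt0]; rewrite leq_eqVlt => /predU1P[->|le_kr].
  (* At the new index [r.+1], the size of [a], the summands are known only as members, so [index]
     recovers their positions. *)
  exists (index x a), (index y a); rewrite !nth_rcons !index_mem xa ya.
  by rewrite !nth_index // sz_a ltnn eqxx -sz_a !index_mem.
have [|i [j [lt_ik lt_jk ak]]] := a_step k; first by rewrite k_gt0.
exists i, j; rewrite !nth_rcons sz_a le_kr.
by rewrite (ltn_trans lt_ik le_kr) (ltn_trans lt_jk le_kr).
Qed.

(** Each step adds the last entry to itself. Membership of [m] is carried along so that [m] is still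
    available as a summand after the doublings. *)
Lemma addition_chain_doublings (m r k : nat) (a : seq nat) :
  addition_chain m r a ->
  exists2 b, addition_chain (2 ^ k * m) (r + k) b & m \in b.
Proof.
move=> a_chain; elim: k => [|k [b b_chain mb]].
  by exists a; rewrite ?mul1n ?addn0 //; exact: (addition_chain_last _ _ _ a_chain).
have b_last := addition_chain_last _ _ _ b_chain.
exists (rcons b (2 ^ k * m + 2 ^ k * m)); last by rewrite mem_rcons inE mb orbT.
rewrite expnS -mulnA mul2n -addnn addnS.
exact: (addition_chain_rcons _ _ _ _ _ b_chain b_last b_last).
Qed.

Lemma ell_mul_pow2_add1 (m k : nat) :
  0 < m -> ell ((2 ^ k).+1 * m) <= ell m + k.+1.
Proof.
move=> m_gt0; have [[a a_chain] _] := ellP m_gt0.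
have [b b_chain mb] := addition_chain_doublings _ _ k _ a_chain.
have [|_] := @ellP ((2 ^ k).+1 * m); first by rewrite muln_gt0.
apply; exists (rcons b (2 ^ k * m + m)); rewrite mulSn addnC addnS.
exact: (addition_chain_rcons _ _ _ _ _ b_chain (addition_chain_last _ _ _ b_chain) mb).
Qed.

Theorem theorem5 (n : nat) (n_gt0 : 0 < n)
  (ell_double : ell (2 * n) = ell n + 1)
  (scholz_n : ell (2 ^ n - 1) <= ell n + n - 1) :
  ell (2 ^ (2 * n) - 1) <= ell (2 * n) + 2 * n - 1.
Proof.
have m_gt0 : 0 < 2 ^ n - 1 by rewrite subn_gt0 -{1}(expn0 2) ltn_exp2l.
(* Difference of squares, with the subtracted [1] read as [1 ^ 2]. *)
have -> : 2 ^ (2 * n) - 1 = (2 ^ n).+1 * (2 ^ n - 1).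
  by rewrite [2 * n]mulnC expnM -[(2 ^ n).+1]addn1 [RHS]mulnC; exact: (subn_sqr _ 1).
have := ell_mul_pow2_add1 _ n m_gt0.
(* With [m = 2 ^ n - 1]: [ell m + n.+1 <= (ell n + n - 1) + n.+1 = ell n + 2 * n], which is the
   target by [ell_double]. Truncated subtraction is harmless since [0 < n]. *)
by lia.
Qed.
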